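(* Let $n\ge d$, let $\mathcal P\in\mathbb R^{d\times n}$ be minimal with $\text{rank}(\mathcal P)=d$, and let $\mathbb Q\sim\mathbb P$ be a pricing measure. Fix $x\ge 0$, and suppose that the $\mathbb R^n$-valued process $\mathbf X$ is $\mathbb Q$-integrable and $\mathbb Q$-affine, with $\mathcal A$ and $\mathbf a$ homogeneous, i.e. $\mathcal A(t,T)=\mathcal A(T-t)$ and $\mathbf a(t,T)=\mathbf a(T-t)$. Let $\mathbf S(t)=\mathcal P\mathbf X(t)$ and $$\mathbf f(t,x)=\mathbb E_{\mathbb Q}[\mathbf S(t+x)\,|\,\mathcal F_t],\qquad t\ge 0 .$$ Then $t\mapsto\mathbf f(t,x)$ is cointegrated if there exists a vector $\mathbf c\in\mathbb R^d$ such that $\mathbf c^{\top}\mathcal P\mathcal A(x)\in\mathcal C_{\mathbf X}$, or, equivalently, $(\mathcal P\mathcal A(x),\mathbf c)$ is a cointegrated pricing system for $\mathbf X$.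
   Context: The setting is a complete filtered probability space $(\Omega,\mathcal F,\{\mathcal F_t\}_{t\ge 0},\mathbb P)$ satisfying the usual conditions, with $\mathbf X=\{\mathbf X(t)\}_{t\ge 0}$ an adapted $\mathbb R^n$-valued process (the factor process). $\mathbf X$ is $\mathbb Q$-integrable if $\mathbf X(t)$ is $\mathbb Q$-integrable for all $t$. $\mathbf X$ is $\mathbb Q$-affine if there exist measurable deterministic functions $(t,T)\mapsto\mathcal A(t,T)\in\mathbb R^{n\times n}$ and $(t,T)\mapsto\mathbf a(t,T)\in\mathbb R^n$ such that $\mathbb E_{\mathbb Q}[\mathbf X(T)\,|\,\mathcal F_t]=\mathcal A(t,T)\mathbf X(t)+\mathbf a(t,T)$ for $0\le t\le T<\infty$. A matrix $\mathcal M\in\mathbb R^{d\times n}$ is minimal if all factors $X_1,\ldots,X_n$ are represented in $\mathcal M\mathbf X(t)$, that is, if $\mathcal M\mathbf e_i\neq 0$ for every canonical basis vector $\mathbf e_i$ of $\mathbb R^n$, $i=1,\ldots,n$. An $\mathbb R^k$-valued process $\mathbf Y$ is cointegrated, with cointegration vector $\mathbf c\in\mathbb R^k$, if the distribution of $\mathbf c^{\top}\mathbf Y(t)$ converges weakly, as $t\to\infty$, to a probability distribution on $\mathbb R$ ($\mathbf c=\mathbf 0$ is allowed). $\mathcal C_{\mathbf X}\subset\mathbb R^n$ is the set of all cointegration vectors of $\mathbf X$; a row vector $\mathbf c^{\top}\mathcal M$ is said to belong to $\mathcal C_{\mathbf X}$ if its transpose $\mathcal M^{\top}\mathbf c$ does.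 Distributions (hence cointegration) are considered under the pricing measure $\mathbb Q$. If $\mathcal M\in\mathbb R^{d\times n}$ is a pricing matrix, i.e. minimal and with $\text{rank}(\mathcal M)=d$, and $\mathbf c\in\mathbb R^d$ is such that $\mathcal M^{\top}\mathbf c\in\mathcal C_{\mathbf X}$, then $(\mathcal M,\mathbf c)$ is called a cointegrated pricing system for the factor process $\mathbf X$.
   Formalization: The equivalence with ''(PA(x), c) is a cointegrated pricing system'' is stated only when PA(x) is itself minimal of rank d; without this it fails (X=0, A=0, a=0). Sufficiency of each condition is stated without this assumption. *)

(* Defs.v *)
From HB Require Import structures.
From mathcomp Require Import all_boot all_order all_algebra.
From mathcomp Require Import all_classical all_reals all_analysis.

Set Implicit Arguments.
Unset Strict Implicit.
Unset Printing Implicit Defensive.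

Import Order.TTheory GRing.Theory Num.Theory.
Import numFieldNormedType.Exports.

Local Open Scope classical_set_scope.
Local Open Scope ring_scope.

(* Time is [0, +oo[: processes and filtrations are families indexed by R, and
   their values at negative times are never constrained nor used. *)

Definition filtration d (T : measurableType d) (R : realType)
    (F : R -> set (set T)) : Prop :=
  (forall t, 0 <= t -> sigma_algebra setT (F t) /\ F t `<=` measurable) /\
  (forall s t, 0 <= s -> s <= t -> F s `<=` F t).

Definition usual_conditions d (T : measurableType d) (R : realType)
    (P : probability T R) (F : R -> set (set T)) : Prop :=
  [/\ measure_is_complete P,
      P.-negligible `<=` F 0
    & forall t, 0 <= t -> F t = \bigcap_(s in [set s | t < s]) F s].

Definition equivalent_measures d (T : measurableType d) (R : realType)
    (Q P : probability T R) : Prop := Q `<< P /\ P `<< Q.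

(* Measurability of Y with respect to a sub-sigma-algebra G, which is a set of
   subsets and not a measurableType. *)
Definition sub_measurable d (T : measurableType d) (R : realType)
    (G : set (set T)) (Y : T -> R) : Prop :=
  forall B : set R, measurable B -> G (Y @^-1` B).

Definition adapted d (T : measurableType d) (R : realType) (k : nat)
    (F : R -> set (set T)) (Y : R -> T -> 'cV[R]_k) : Prop :=
  forall t, 0 <= t -> forall i, sub_measurable (F t) (fun w => Y t w i 0).

Definition integrable_vector d (T : measurableType d) (R : realType) (k : nat)
    (Q : probability T R) (Y : T -> 'cV[R]_k) : Prop :=
  forall i, Q.-integrable setT (fun w => (Y w i 0)%:E).

Definition integrable_process d (T : measurableType d) (R : realType) (k : nat)
    (Q : probability T R) (Y : R -> T -> 'cV[R]_k) : Prop :=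
  forall t, 0 <= t -> integrable_vector Q (Y t).

(* Z is a version of E_Q[Y | G]; conditional expectations being defined up to
   Q-null sets, an equation E_Q[Y | G] = Z is read as this relation. *)
Definition is_cond_exp d (T : measurableType d) (R : realType) (k : nat)
    (Q : probability T R) (G : set (set T)) (Y Z : T -> 'cV[R]_k) : Prop :=
  [/\ integrable_vector Q Y, integrable_vector Q Z,
      forall i, sub_measurable G (fun w => Z w i 0)
    & forall (i : 'I_k) (B : set T), G B ->
        (\int[Q]_(w in B) (Z w i 0)%:E = \int[Q]_(w in B) (Y w i 0)%:E)%E].

Definition affine_process d (T : measurableType d) (R : realType) (n : nat)
    (Q : probability T R) (F : R -> set (set T)) (X : R -> T -> 'cV[R]_n)
    (A : R -> R -> 'M[R]_n) (a : R -> R -> 'cV[R]_n) : Prop :=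
  let times := [set p : R * R | 0 <= p.1 <= p.2] in
  [/\ forall i j, measurable_fun times (fun p : R * R => A p.1 p.2 i j),
      forall i, measurable_fun times (fun p : R * R => a p.1 p.2 i 0)
    & forall t u, 0 <= t -> t <= u ->
        is_cond_exp Q (F t) (X u) (fun w => A t u *m X t w + a t u)].

Definition weakly_converges (R : realType)
    (nu : R -> set R -> \bar R) (mu : probability R R) : Prop :=
  forall g : R -> R, continuous g -> bounded_fun g ->
    (\int[nu t]_y (g y)%:E)%E @[t --> +oo] --> (\int[mu]_y (g y)%:E)%E.

Definition cointegrated d (T : measurableType d) (R : realType) (k : nat)
    (Q : probability T R) (Y : R -> T -> 'cV[R]_k) (c : 'cV[R]_k) : Prop :=
  exists mu : probability R R,
    weakly_converges
      (fun t => pushforward Q (fun w => (c^T *m Y t w) 0 0)) mu.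

Definition cointegration_vectors d (T : measurableType d) (R : realType)
    (n : nat) (Q : probability T R) (X : R -> T -> 'cV[R]_n) : set 'cV[R]_n :=
  [set c | cointegrated Q X c].

Definition minimal (R : realType) (m n : nat) (M : 'M[R]_(m, n)) : Prop :=
  forall i : 'I_n, M *m (delta_mx i 0 : 'cV[R]_n) != 0.

Definition pricing_matrix (R : realType) (m n : nat) (M : 'M[R]_(m, n)) : Prop :=
  minimal M /\ \rank M = m.

Definition cointegrated_pricing_system d (T : measurableType d) (R : realType)
    (m n : nat) (Q : probability T R) (X : R -> T -> 'cV[R]_n)
    (M : 'M[R]_(m, n)) (c : 'cV[R]_m) : Prop :=
  pricing_matrix M /\ cointegration_vectors Q X (M^T *m c).

(* Main.v *)
Require Import Defs.
From HB Require Import structures.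
From mathcomp Require Import all_boot all_order all_algebra.
From mathcomp Require Import all_classical all_reals all_analysis.
From mathcomp Require Import measurable_realfun.

Import Order.TTheory GRing.Theory Num.Theory.
Import numFieldNormedType.Exports.

Local Open Scope classical_set_scope.
Local Open Scope ring_scope.

(** The affine property applied at times [t <= t + x], multiplied by [M],
    says that [M (A(x) X(t) + a(x))] is a version of the conditional expectation
    of [S(t + x) = M X(t + x)] given [F t]. Any two versions agree almost surely
    ([is_cond_exp_unique]), hence, almost surely,

      c^T f(t, x) = ((M A(x))^T c)^T X(t) + c^T M a(x),    t >= 0.

    By homogeneity the coefficients on the right do not depend on [t]. So the
    scalar process whose law must converge is the one whose law does converge,
    by the cointegration hypothesis, up to null sets and a translation by a
    constant. Neither affects weak convergence: the limit is translated by the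
    same constant ([weakly_converges_ae_shift]). *)

Section sub_sigma_algebra.
Context {d : measure_display} {T : measurableType d} {R : realType}.
Context {G : set (set T)}.
Hypothesis sG : sigma_algebra setT G.

Let GT : measurableType _ := g_sigma_algebraType G.

Lemma measurable_sub_sigma_algebraE (B : set T) :
  measurable (B : set GT) = G B.
Proof. by rewrite /measurable/= /measurable sigma_algebra_id. Qed.

(** Turns measurability with respect to a family of sets into measurability on
    a type, which makes the closure properties of [measurable_fun] available. *)
Lemma sub_measurableP (Y : T -> R) :
  sub_measurable G Y <-> measurable_fun setT (Y : GT -> R).
Proof.
split=> [hY _ B mB|hY B mB].
  by rewrite setTI measurable_sub_sigma_algebraE; exact: hY.
by rewrite -measurable_sub_sigma_algebraE -[_ @^-1` _]setTI; exact: hY.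
Qed.

Lemma sub_measurable_mulmx {k m : nat} (N : 'M[R]_(m, k)) {Y : T -> 'cV[R]_k} :
  (forall j, sub_measurable G (fun w => Y w j 0)) ->
  forall i, sub_measurable G (fun w => (N *m Y w) i 0).
Proof.
move=> hY i; apply/sub_measurableP; under eq_fun do rewrite mxE.
apply: measurable_sum => j; apply: measurable_funM => //.
exact/sub_measurableP.
Qed.

(** The proof moves [Q] to the coarser measurable space [GT], as its image
    under the identity: there the sets on which the integrals are known to
    agree are all the measurable ones, which forces almost sure equality. *)
Lemma sub_measurable_eq_integral_ae (Q : probability T R) {u v : T -> R} :
  G `<=` measurable ->
  sub_measurable G u -> sub_measurable G v ->
  Q.-integrable setT (fun w => (u w)%:E) ->
  Q.-integrable setT (fun w => (v w)%:E) ->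
  (forall B, G B ->
     (\int[Q]_(w in B) (u w)%:E = \int[Q]_(w in B) (v w)%:E)%E) ->
  {ae Q, forall w, u w = v w}.
Proof.
move=> GM /sub_measurableP mu /sub_measurableP mv iu iv huv.
have memb : measurable_fun setT (id : T -> GT).
  by move=> _ B; rewrite measurable_sub_sigma_algebraE setTI; exact: GM.
have meu : measurable_fun setT (fun w : GT => (u w)%:E).
  exact/measurable_EFinP.
have mev : measurable_fun setT (fun w : GT => (v w)%:E).
  exact/measurable_EFinP.
pose emb : {mfun T >-> GT} := mfun_Sub (mem_set memb).
pose Q' := distribution Q emb.
have iu' : Q'.-integrable setT (fun w => (u w)%:E).
  exact: (integrable_pushforward memb).
have [N [mN N0 sN]] :
    ae_eq Q' setT (fun w => (u w)%:E) (fun w => (v w)%:E).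
  apply: integral_ae_eq => // E _ mE.
  have mE' : measurable (E : set T).
    by apply: GM; rewrite -measurable_sub_sigma_algebraE.
  have intE (y : T -> R) : Q.-integrable setT (fun w => (y w)%:E) ->
    Q.-integrable (emb @^-1` E) (fun w => (y w)%:E).
    exact: integrableS.
  rewrite !(integral_pushforward memb) //; [|exact: intE..].
  by apply: huv; rewrite -measurable_sub_sigma_algebraE.
exists N; split => //.
  by apply: GM; rewrite -measurable_sub_sigma_algebraE.
by apply: subset_trans sN => w /= uv /(_ I) [].
Qed.

End sub_sigma_algebra.

Section conditional_expectation.
Context {d : measure_display} {T : measurableType d} {R : realType}.
Context (Q : probability T R) {G : set (set T)}.
Hypotheses (sG : sigma_algebra setT G) (GM : G `<=` measurable).

Lemma integrable_vector_mulmx {k m : nat} (N : 'M[R]_(m, k))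
    (Y : T -> 'cV[R]_k) :
  integrable_vector Q Y -> integrable_vector Q (fun w => N *m Y w).
Proof.
move=> hY i; under eq_fun do rewrite mxE -sumEFin.
by apply: integrable_sum => // j _; under eq_fun do rewrite EFinM;
  exact: integrableZl.
Qed.

Lemma integral_mulmx {k m : nat} (N : 'M[R]_(m, k)) (Y : T -> 'cV[R]_k)
    (i : 'I_m) (B : set T) :
  measurable B -> integrable_vector Q Y ->
  (\int[Q]_(w in B) ((N *m Y w) i 0)%:E =
   \sum_(j < k) (N i j)%:E * \int[Q]_(w in B) (Y w j 0)%:E)%E.
Proof.
move=> mB hY.
have iB j : Q.-integrable B (fun w => (Y w j 0)%:E).
  exact: integrableS (hY j).
under eq_integral do rewrite mxE -sumEFin.
rewrite integral_sum //; last first.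
  by move=> j; under eq_fun do rewrite EFinM; exact: integrableZl.
apply: eq_bigr => j _; under eq_integral do rewrite EFinM.
exact: integralZl.
Qed.

Lemma is_cond_exp_mulmx {k m : nat} (N : 'M[R]_(m, k))
    {Y Z : T -> 'cV[R]_k} :
  is_cond_exp Q G Y Z ->
  is_cond_exp Q G (fun w => N *m Y w) (fun w => N *m Z w).
Proof.
move=> [iY iZ mZ eYZ]; split; [exact: integrable_vector_mulmx..| |].
- exact: sub_measurable_mulmx.
- move=> i B GB; have mB := GM _ GB.
  by rewrite !integral_mulmx //; apply: eq_bigr => j _; rewrite eYZ.
Qed.

Lemma is_cond_exp_unique {k : nat} {Y Z Z' : T -> 'cV[R]_k} :
  is_cond_exp Q G Y Z -> is_cond_exp Q G Y Z' ->
  {ae Q, forall w, Z w = Z' w}.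
Proof.
move=> [_ iZ mZ eZ] [_ iZ' mZ' eZ'].
have : \forall w \near almost_everywhere Q, forall i, Z w i 0 = Z' w i 0.
  apply: filter_forall => i.
  apply: (sub_measurable_eq_integral_ae sG) => // B GB.
  by rewrite eZ ?eZ'.
by apply: filterS => w eZZ'; apply/colP.
Qed.

End conditional_expectation.

Lemma bounded_fun_comp {S S' : Type} {R : realType} {g : S' -> R}
    (h : S -> S') : bounded_fun g -> bounded_fun (fun w => g (h w)).
Proof. by case=> N [rN gN]; exists N; split=> // z /gN hz y _; exact: hz. Qed.

Lemma integrable_bounded_comp {d : measure_display} {T : measurableType d}
    {R : realType} (Q : probability T R) {U : T -> R} {g : R -> R} :
  measurable_fun setT U -> continuous g -> bounded_fun g ->
  Q.-integrable setT (fun w => (g (U w))%:E).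
Proof.
move=> mU cg bg; apply: measurable_bounded_integrable => //.
- exact: le_lt_trans (probability_le1 Q measurableT) (ltry _).
- exact: measurableT_comp (continuous_measurable_fun cg) mU.
- exact: bounded_fun_comp U bg.
Qed.

Lemma integral_bounded_pushforward {d : measure_display} {T : measurableType d}
    {R : realType} (Q : probability T R) {U : T -> R} {g : R -> R} :
  measurable_fun setT U -> continuous g -> bounded_fun g ->
  (\int[pushforward Q U]_y (g y)%:E = \int[Q]_w (g (U w))%:E)%E.
Proof.
move=> mU cg bg; rewrite (integral_pushforward mU) //.
- by apply/measurable_EFinP; exact: continuous_measurable_fun.
- by rewrite preimage_setT; exact: integrable_bounded_comp.
Qed.

(** Testing the law of [V t] against [g] is testing the law of [U t] against
    the translate of [g], again continuous and bounded; the limit law is thus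
    the image of [mu] under the translation. The hypotheses at nonnegative
    times suffice because the limit is taken at [+oo]. *)
Lemma weakly_converges_ae_shift {d : measure_display} {T : measurableType d}
    {R : realType} (Q : probability T R) {U V : R -> T -> R} (k : R)
    {mu : probability R R} :
  (forall t, 0 <= t -> measurable_fun setT (U t)) ->
  (forall t, 0 <= t -> measurable_fun setT (V t)) ->
  (forall t, 0 <= t -> {ae Q, forall w, V t w = U t w + k}) ->
  weakly_converges (fun t => pushforward Q (U t)) mu ->
  exists nu : probability R R,
    weakly_converges (fun t => pushforward Q (V t)) nu.
Proof.
move=> mU mV eVU Umu.
have mk : measurable_fun setT (fun y : R => y + k) by exact: measurable_funD.
pose shift : {mfun R >-> R} := mfun_Sub (mem_set mk).
exists (distribution mu shift) => g cg bg.
have cgk : continuous (fun y => g (y + k)).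
  move=> y; apply: continuous_comp; last exact: cg.
  by apply: cvgD; [exact: cvg_id|exact: cvg_cst].
have bgk := bounded_fun_comp (fun y => y + k) bg.
rewrite (integral_bounded_pushforward mu mk cg bg).
apply: cvg_trans (Umu _ cgk bgk).
apply: near_eq_cvg; near=> t.
have t0 : 0 <= t by near: t; exact: nbhs_pinfty_ge.
rewrite (integral_bounded_pushforward Q (mU t t0) cgk bgk).
rewrite (integral_bounded_pushforward Q (mV t t0) cg bg).
apply: ae_eq_integral => //.
- exact: measurable_int (integrable_bounded_comp Q (mU t t0) cgk bgk).
- exact: measurable_int (integrable_bounded_comp Q (mV t t0) cg bg).
- by apply: filterS (eVU t t0) => w /= ->.
Unshelve. all: by end_near.
Qed.

Theorem proposition14 (R : realType) (disp : measure_display)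
    (Omega : measurableType disp) (P Q : probability Omega R)
    (F : R -> set (set Omega)) (n d : nat)
    (X : R -> Omega -> 'cV[R]_n) (M : 'M[R]_(d, n))
    (A : R -> 'M[R]_n) (a : R -> 'cV[R]_n) (x : R)
    (f : R -> Omega -> 'cV[R]_d)
    (hF : filtration F) (hPF : usual_conditions P F)
    (hX : adapted F X) (hdn : (d <= n)%N)
    (hM : minimal M) (hrk : \rank M = d)
    (hQP : equivalent_measures Q P) (hx : 0 <= x)
    (hXint : integrable_process Q X)
    (hXaff : affine_process Q F X (fun t u => A (u - t)) (fun t u => a (u - t)))
    (hf : forall t : R, 0 <= t ->
       is_cond_exp Q (F t) (fun w => M *m X (t + x) w) (f t)) :
  [/\ (* sufficiency of the condition c^T M A(x) \in C_X *)
      (forall c : 'cV[R]_d,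
         cointegration_vectors Q X ((M *m A x)^T *m c) -> cointegrated Q f c),
      (* sufficiency of the condition on pricing systems *)
      (forall c : 'cV[R]_d,
         cointegrated_pricing_system Q X (M *m A x) c -> cointegrated Q f c)
    & (* equivalence of the two conditions when M A(x) is a pricing matrix *)
      (pricing_matrix (M *m A x) -> forall c : 'cV[R]_d,
         cointegration_vectors Q X ((M *m A x)^T *m c) <->
         cointegrated_pricing_system Q X (M *m A x) c)].
Proof.
(* The other two claims follow from this one by unfolding pricing systems. *)
have suffC c :
    cointegration_vectors Q X ((M *m A x)^T *m c) -> cointegrated Q f c.
  move=> [mu Xmu].
  have sF t (t0 : 0 <= t) : sigma_algebra setT (F t) := (hF.1 t t0).1.
  have FM t (t0 : 0 <= t) : F t `<=` measurable := (hF.1 t t0).2.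
  have mproj k t (Y : Omega -> 'cV[R]_k) (b : 'cV[R]_k) : 0 <= t ->
      (forall i, sub_measurable (F t) (fun w => Y w i 0)) ->
      measurable_fun setT (fun w => (b^T *m Y w) 0 0).
    move=> t0 mY _ B mB; rewrite setTI; apply: (FM t t0).
    exact: (sub_measurable_mulmx (sF t t0) b^T mY 0 _ mB).
  pose k := (c^T *m (M *m a x)) 0 0.
  apply: (weakly_converges_ae_shift Q k _ _ _ Xmu) => t t0.
  - exact: (mproj _ _ _ _ t0 (hX t t0)).
  - by apply: (mproj _ _ _ _ t0); case: (hf t t0).
  - case: hXaff => _ _ /(_ t (t + x) t0); rewrite lerDl => /(_ hx).
    rewrite addrAC subrr add0r.
    move=> /(is_cond_exp_mulmx Q (sF t t0) (FM t t0) M) hMX.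
    apply: filterS (is_cond_exp_unique Q (sF t t0) (FM t t0) (hf t t0) hMX).
    move=> w ->.
    by rewrite /k trmx_mul trmxK !mulmxDr !mulmxA mxE.
split=> // [c [_ /suffC]//|hMA c].
by split=> [hc|[_]//]; split.
Qed.
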